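(* Let $0<p\leq 1$. Suppose $(\mathcal{M},\rho)$ is a $p$-metric space that is either unbounded, or whose completion contains a limit point. Then for every $t>1$ there exists an infinite countable set $\mathcal{N}\subset\mathcal{M}$ such that: (i) the space $\mathcal{F}_{p}(\mathcal{N})$ is $2^{1/p-1}t$-isomorphic to $\ell_{p}$; and (ii) the canonical map $L_{\jmath}\colon\mathcal{F}_{p}(\mathcal{N})\to\mathcal{F}_{p}(\mathcal{M})$ is an isomorphic embedding, where $\jmath\colon\mathcal{N}\to\mathcal{M}$ is the inclusion. Quantitatively, $\Vert L_{\jmath}^{-1}\Vert\le 2^{1/p-1}t$, where $L_{\jmath}^{-1}$ is defined on the range of $L_{\jmath}$.
   Context: Let $0<p\le 1$. A $p$-metric on a set $\mathcal{M}$ is a symmetric map $d\colon\mathcal{M}\times\mathcal{M}\to[0,\infty)$ with $d(x,y)=0$ iff $x=y$ and $d^p(x,y)\le d^p(x,z)+d^p(z,y)$ for all $x,y,z$. A $p$-Banach space is a complete real vector space with a $p$-norm, i.e. a quasi-norm with $\|x+y\|^p\le\|x\|^p+\|y\|^p$. For a $p$-metric space $\mathcal{M}$ with base point $0$, the Lipschitz free $p$-space $\mathcal{F}_p(\mathcal{M})$ is the $p$-Banach space, unique up to linear isometry, with an isometric embedding $\delta_{\mathcal{M}}\colon\mathcal{M}\to\mathcal{F}_p(\mathcal{M})$, $\delta_{\mathcal{M}}(0)=0$, such that for every $p$-Banach space $X$ and every Lipschitz map $f\colon\mathcal{M}\to X$ with $f(0)=0$ there is a unique bounded linear map $T_f\colon\mathcal{F}_p(\mathcal{M})\to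 X$ with $T_f\circ\delta_{\mathcal{M}}=f$, and $\|T_f\|=\mathrm{Lip}(f)$. The linear span of $\delta_{\mathcal{M}}(\mathcal{M})$ is dense in $\mathcal{F}_p(\mathcal{M})$. Changing the base point yields a linearly isometric space. For a subset $\mathcal{N}\subset\mathcal{M}$ with inclusion $\jmath$ (the common base point being taken in $\mathcal{N}$), $L_\jmath\colon\mathcal{F}_p(\mathcal{N})\to\mathcal{F}_p(\mathcal{M})$ is the bounded linear map with $L_\jmath(\delta_{\mathcal{N}}(x))=\delta_{\mathcal{M}}(x)$ for $x\in\mathcal{N}$. Two spaces are $C$-isomorphic if there is an onto linear isomorphism $T$ between them with $\|T\|\,\|T^{-1}\|\le C$. A limit point of a space is a non-isolated point of it. *)

(* Defs.v *)
From HB Require Import structures.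
From mathcomp Require Import all_boot all_order all_algebra.
From mathcomp Require Import all_classical all_reals all_analysis.
Set Implicit Arguments.
Unset Strict Implicit.
Unset Printing Implicit Defensive.
Import Order.TTheory GRing.Theory Num.Theory.
Import numFieldNormedType.Exports.
Local Open Scope classical_set_scope.
Local Open Scope ring_scope.

Record pMetric (R : realType) (p : R) := PMetric {
  pmet_sort :> Type;
  pdist : pmet_sort -> pmet_sort -> R;
  pdist_ge0 : forall x y, 0 <= pdist x y;
  pdist_eq0 : forall x y, pdist x y = 0 <-> x = y;
  pdistC : forall x y, pdist x y = pdist y x;
  pdist_triangle : forall x y z,
    pdist x y `^ p <= pdist x z `^ p + pdist z y `^ p }.

Section pMetric_theory.
Context (R : realType) (p : R).
Implicit Types M C : pMetric p.

Section subspace.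
Context (M : pMetric p) (N : set M).

Let subd (x y : N) : R := pdist (set_val x) (set_val y).

Let subd_eq0 x y : subd x y = 0 <-> x = y.
Proof. by split=> [/pdist_eq0/val_inj//|->]; apply/pdist_eq0. Qed.

Definition sub_pMetric : pMetric p :=
  @PMetric R p N subd (fun x y => pdist_ge0 _ _) subd_eq0
    (fun x y => pdistC _ _) (fun x y z => pdist_triangle _ _ _).

End subspace.

Definition punbounded M := forall K : R, exists x y : M, K < pdist x y.

Definition pmet_complete M := forall u : nat -> M,
  (forall e, 0 < e -> exists n0, forall m n, (n0 <= m)%N -> (n0 <= n)%N ->
     pdist (u m) (u n) < e) ->
  exists l : M, (fun n => pdist (u n) l) @ \oo --> 0.

(* C is a completion of M through the dense isometric embedding i. *)
Definition is_completion M C (i : M -> C) :=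
  [/\ pmet_complete C,
      (forall x y, pdist (i x) (i y) = pdist x y) &
      (forall (c : C) e, 0 < e -> exists x, pdist (i x) c < e)].

Definition is_limit_point C (x : C) :=
  forall e, 0 < e -> exists y : C, y <> x /\ pdist x y < e.

(* Completions exist and are unique up to isometry, so that it does not matter
   which one is used. *)
Definition completion_has_limit_point M :=
  exists (C : pMetric p) (i : M -> C),
    is_completion i /\ exists x : C, is_limit_point x.

End pMetric_theory.

(* The norm of a normedModType is subadditive, whence this structure for
   0 < p < 1. *)
Record pBanach (R : realType) (p : R) := PBanach {
  pban_sort :> lmodType R;
  pnorm : pban_sort -> R;
  pnorm_ge0 : forall x, 0 <= pnorm x;
  pnorm_eq0 : forall x, pnorm x = 0 -> x = 0;
  pnormZ : forall (a : R) x, pnorm (a *: x) = `|a| * pnorm x;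
  pnormD : forall x y, pnorm (x + y) `^ p <= pnorm x `^ p + pnorm y `^ p;
  pban_complete : forall u : nat -> pban_sort,
    (forall e, 0 < e -> exists n0, forall m n, (n0 <= m)%N -> (n0 <= n)%N ->
       pnorm (u m - u n) < e) ->
    exists l, (fun n => pnorm (u n - l)) @ \oo --> 0 }.

Section operators.
Context (R : realType) (p : R).
Implicit Types X Y : pBanach p.

Definition bounded_op_on X Y (A : set X) (T : X -> Y) :=
  exists K : R, forall x, A x -> pnorm (T x) <= K * pnorm x.

(* Meaningful for a T that is homogeneous and bounded on A, with A closed under
   scaling. *)
Definition opnorm_on X Y (A : set X) (T : X -> Y) : R :=
  sup [set pnorm (T x) | x in [set x | A x /\ pnorm x <= 1]].

Definition bounded_op X Y (T : X -> Y) := bounded_op_on setT T.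

Definition opnorm X Y (T : X -> Y) : R := opnorm_on setT T.

Definition C_isomorphic (C : R) X Y :=
  exists (T : {linear X -> Y}) (S : {linear Y -> X}),
    [/\ cancel T S, cancel S T, bounded_op T, bounded_op S
      & opnorm T * opnorm S <= C].

End operators.

Section free.
Context (R : realType) (p : R).
Implicit Types (M : pMetric p) (X F : pBanach p).

Definition lipschitz_map M X (f : M -> X) :=
  exists K : R, forall x y, pnorm (f x - f y) <= K * pdist x y.

(* Meaningful for Lipschitz f; equal to 0 when M is a singleton, since
   sup set0 = 0. *)
Definition Lip M X (f : M -> X) : R :=
  sup [set pnorm (f z.1 - f z.2) / pdist z.1 z.2 |
        z in [set z : M * M | z.1 <> z.2]].

(* (F, delta) is a Lipschitz free p-space over M with base point o; this
   determines (F, delta) up to a linear isometry. *)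
Definition is_free_pspace M (o : M) F (delta : M -> F) :=
  [/\ (forall x y, pnorm (delta x - delta y) = pdist x y),
      delta o = 0 &
      forall X (f : M -> X), lipschitz_map f -> f o = 0 ->
        exists T : {linear F -> X},
          [/\ bounded_op T, (forall x, T (delta x) = f x), opnorm T = Lip f &
              forall T' : {linear F -> X}, bounded_op T' ->
                (forall x, T' (delta x) = f x) -> T' =1 T]].

(* L^-1 is represented by a map g on the whole of F2 that inverts L on the
   range of L; its values outside the range are irrelevant. *)
Definition isomorphic_embedding (C : R) F1 F2 (L : F1 -> F2) :=
  bounded_op L /\
  exists g : F2 -> F1,
    [/\ cancel L g, bounded_op_on (range L) g & opnorm_on (range L) g <= C].

End free.

Section lp.
Context (R : realType) (p : R).
Hypotheses (p_gt0 : 0 < p) (p_le1 : p <= 1).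
Implicit Types a b : nat -> R.

Definition lp_pow a : nat -> R := fun n => `|a n| `^ p.

Definition lp_set : set (nat -> R) := [set a | cvgn (series (lp_pow a))].

Let p_neq0 : p != 0. Proof. by rewrite gt_eqF. Qed.

Lemma powRD_le (x y : R) : 0 <= x -> 0 <= y ->
  (x + y) `^ p <= x `^ p + y `^ p.
Proof.
move=> x0 y0; have [s0|s0] := eqVneq (x + y) 0.
  by rewrite s0 powR0// addr_ge0// powR_ge0.
have sgt0 : 0 < x + y by rewrite lt0r s0 addr_ge0.
have H z : 0 <= z -> z <= x + y -> z / (x + y) * (x + y) `^ p <= z `^ p.
  move=> z0 zs; have [->|zn0] := eqVneq z 0; first by rewrite !mul0r powR_ge0.
  have -> : z `^ p = (z / (x + y)) `^ p * (x + y) `^ p.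
    by rewrite -powRM ?divr_ge0 ?(ltW sgt0)// divfK.
  apply: ler_wpM2r; first exact: powR_ge0.
  apply: ger1_powR => //.
  apply/andP; split; first by rewrite divr_gt0// lt0r zn0.
  by rewrite ler_pdivrMr// mul1r.
apply: le_trans (lerD (H x _ _) (H y _ _)) => //; rewrite ?lerDl ?lerDr//.
by rewrite -mulrDl -mulrDl divff// mul1r.
Qed.

Lemma lp_pow_ge0 a n : 0 <= lp_pow a n. Proof. exact: powR_ge0. Qed.

Lemma nondecreasing_lp a : nondecreasing_seq (series (lp_pow a)).
Proof. by apply: nondecreasing_series => n _ _; exact: lp_pow_ge0. Qed.

Lemma lp_powD a b n : lp_pow (a + b) n <= lp_pow a n + lp_pow b n.
Proof.
apply: le_trans (powRD_le (normr_ge0 _) (normr_ge0 _)).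
by apply: (ge0_ler_powR (ltW p_gt0)); rewrite ?nnegrE ?(ltW p_gt0)//; exact: ler_normD.
Qed.

Lemma lp_partial_le a n : lp_set a ->
  series (lp_pow a) n <= limn (series (lp_pow a)).
Proof. by move=> ca; apply: nondecreasing_cvgn_le => //; exact: nondecreasing_lp. Qed.

Lemma lp_partial_bound a (B : R) : (forall n, series (lp_pow a) n <= B) ->
  lp_set a /\ limn (series (lp_pow a)) <= B.
Proof.
move=> aB; have ca : lp_set a.
  apply: nondecreasing_is_cvgn; first exact: nondecreasing_lp.
  by exists B => _ [n _ <-].
by split=> //; apply: limr_le => //; near=> n; exact: aB.
Unshelve. all: by end_near. Qed.

Lemma lp_setD a b : lp_set a -> lp_set b -> lp_set (a + b) /\
  limn (series (lp_pow (a + b))) <=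
  limn (series (lp_pow a)) + limn (series (lp_pow b)).
Proof.
move=> ca cb; apply: lp_partial_bound => n.
apply: le_trans (lerD (lp_partial_le n ca) (lp_partial_le n cb)).
rewrite /series /= -big_split; apply: ler_sum => i _; exact: lp_powD.
Qed.

Lemma lp_powZ (c : R) a : lp_pow (c *: a) = (`|c| `^ p) *: lp_pow a.
Proof. by apply/funext => n; rewrite /lp_pow /= !fctE normrM powRM. Qed.

Lemma lp_setZ (c : R) a : lp_set a -> lp_set (c *: a).
Proof. by move=> ca; rewrite /lp_set /= lp_powZ; exact: is_cvg_seriesZ. Qed.

Lemma lp_set0 : lp_set 0.
Proof.
apply: (proj1 (@lp_partial_bound _ 0 _)) => n.
by rewrite /series /= big1// => i _; rewrite /lp_pow normr0 powR0.
Qed.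

Definition lp_pred of 0 < p & p <= 1 : {pred nat -> R} := mem lp_set.

Lemma lp_submod : submod_closed (lp_pred p_gt0 p_le1).
Proof.
split; first by apply/mem_set; exact: lp_set0.
move=> c a b /set_mem la /set_mem lb; apply/mem_set.
by apply: (proj1 (lp_setD _ _)) => //; exact: lp_setZ.
Qed.

End lp.

HB.instance Definition _ (R : realType) (p : R) (p_gt0 : 0 < p) (p_le1 : p <= 1)
  := GRing.isSubmodClosed.Build R (nat -> R) (lp_pred p_gt0 p_le1)
       (lp_submod p_gt0 p_le1).

Definition lp_type (R : realType) (p : R) (p_gt0 : 0 < p) (p_le1 : p <= 1) :=
  {a : nat -> R | a \in lp_pred p_gt0 p_le1}.

Section lp_lmod.
Context (R : realType) (p : R) (p_gt0 : 0 < p) (p_le1 : p <= 1).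
HB.instance Definition _ := SubChoice.on (lp_type p_gt0 p_le1).
HB.instance Definition _ :=
  [SubChoice_isSubLmodule of lp_type p_gt0 p_le1 by <:].
End lp_lmod.

(* Locked, to keep unification from unfolding limn and powR. *)
HB.lock Definition lp_norm (R : realType) (p : R) (p_gt0 : 0 < p)
    (p_le1 : p <= 1) (a : lp_type p_gt0 p_le1) : R :=
  (limn (series (lp_pow p (val a)))) `^ p^-1.

Section lp_pBanach.
Context (R : realType) (p : R) (p_gt0 : 0 < p) (p_le1 : p <= 1).
Local Notation lp := (lp_type p_gt0 p_le1).
Implicit Types a b : lp.

Lemma lpP a : lp_set p (val a). Proof. exact: set_mem (valP a). Qed.
Arguments lpP : clear implicits.

Let p_neq0 : p != 0. Proof. by rewrite gt_eqF. Qed.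

Let lim_ge0 a : 0 <= limn (series (lp_pow p (val a))).
Proof.
have := lp_partial_le 0 (lpP a); apply: le_trans.
by rewrite /series /= big_geq.
Qed.

Lemma lp_norm_powR a : lp_norm a `^ p = limn (series (lp_pow p (val a))).
Proof. by rewrite lp_norm.unlock -powRrM mulVf// powRr1. Qed.

Lemma lp_norm_ge0 a : 0 <= lp_norm a.
Proof. by rewrite lp_norm.unlock powR_ge0. Qed.

Lemma le_lp_norm a n : `|val a n| <= lp_norm a.
Proof.
have H : `|val a n| `^ p <= lp_norm a `^ p.
  rewrite lp_norm_powR; apply: (le_trans _ (lp_partial_le n.+1 (lpP a))).
  rewrite /series /= big_nat_recr//= lerDr sumr_ge0// => i _.
  exact: lp_pow_ge0.
rewrite leNgt; apply/negP => /(@gt0_ltr_powR _ p p_gt0).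
by rewrite !nnegrE lp_norm_ge0 normr_ge0 ltNge H => /(_ isT isT).
Qed.

Lemma lp_norm_eq0 a : lp_norm a = 0 -> a = 0.
Proof.
move=> a0; apply/val_inj/funext => n.
by apply/eqP; rewrite -normr_le0 -a0; exact: le_lp_norm.
Qed.

Lemma lp_normZ (c : R) a : lp_norm (c *: a) = `|c| * lp_norm a.
Proof.
rewrite lp_norm.unlock [val _]/(c *: val a) lp_powZ lim_seriesZ; last exact: lpP.
rewrite [_ *: _]/(_ * _) powRM ?powR_ge0//.
by rewrite -powRrM mulfV// powRr1.
Qed.

Lemma lp_normD a b : lp_norm (a + b) `^ p <= lp_norm a `^ p + lp_norm b `^ p.
Proof.
rewrite !lp_norm_powR.
have [_] := lp_setD p_gt0 p_le1 (lpP a) (lpP b); exact.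
Qed.

Lemma lp_complete (u : nat -> lp) :
  (forall e, 0 < e -> exists n0, forall m n, (n0 <= m)%N -> (n0 <= n)%N ->
     lp_norm (u m - u n) < e) ->
  exists l, (fun n => lp_norm (u n - l)) @ \oo --> 0.
Proof.
move=> cu.
have cvu k : cvgn (fun n => val (u n) k).
  apply/cauchy_cvgP/cauchy_exP => e e0.
  have [n0 hn0] := cu _ e0; exists (val (u n0) k); exists n0 => // n /= hn.
  apply: le_lt_trans (hn0 n0 n (leqnn _) hn).
  exact: (le_lp_norm (u n0 - u n) k).
pose l k := limn (fun n => val (u n) k).
have key e : 0 < e -> exists n0, forall n, (n0 <= n)%N -> forall K,
    series (lp_pow p (val (u n) - l)) K <= e `^ p.
  move=> e0; have [n0 hn0] := cu _ e0; exists n0 => n hn K.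
  pose v m := \sum_(0 <= k < K) `|val (u m) k - l k| `^ p.
  have v0 : v @ \oo --> 0.
    rewrite /v; elim: K {v} => [|K IH].
      by under eq_fun do rewrite big_geq//; exact: cvg_cst.
    under eq_fun do rewrite big_nat_recr//=.
    have c0 : (fun m => `|val (u m) K - l K| `^ p) @ \oo --> (0 : R).
      apply/cvgrPdist_lt => d d0.
      have dp0 : 0 < d `^ p^-1 by exact: powR_gt0.
      have /cvgrPdist_lt/(_ _ dp0) := cvu K.
      apply: filterS => m; rewrite -/(l K) distrC => h.
      rewrite sub0r normrN ger0_norm ?powR_ge0//.
      rewrite [ltRHS](_ : d = (d `^ p^-1) `^ p); last first.
        by rewrite -powRrM mulVf// powRr1// ltW.
      by apply: (gt0_ltr_powR p_gt0); rewrite ?nnegrE ?powR_ge0.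
    by have := cvgD IH c0; rewrite addr0; apply.
  have ve : (fun m => v m + e `^ p) @ \oo --> 0 + e `^ p.
    by apply: cvgD => //; exact: cvg_cst.
  rewrite -[e `^ p]add0r -(cvg_lim (@Rhausdorff R) ve).
  apply: limr_ge; first by apply/cvg_ex; eexists; exact: ve.
  exists n0 => // m /= hm.
  have h1 : series (lp_pow p (val (u n) - val (u m))) K <= e `^ p.
    apply: (le_trans (lp_partial_le K (lpP (u n - u m)))).
    rewrite -lp_norm_powR; apply: (ge0_ler_powR (ltW p_gt0));
      rewrite ?nnegrE ?(ltW p_gt0) ?lp_norm_ge0 ?(ltW e0)//.
    exact/ltW/hn0.
  apply: le_trans (lerD (lexx (v m)) h1).
  rewrite /v /series /= -big_split; apply: ler_sum => k _ /=.
  have -> : val (u n) - l = (val (u m) - l) + (val (u n) - val (u m)).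
    by rewrite [RHS]addrC addrA subrK.
  exact: lp_powD.
have [n1 hn1] := key 1 ltr01.
have [ll _] := lp_partial_bound (hn1 n1 (leqnn _)).
have lin : l \in lp_pred p_gt0 p_le1.
  apply/mem_set; have -> : l = val (u n1) + (-1) *: (val (u n1) - l).
    by rewrite scaleN1r opprB addrC subrK.
  by apply: (proj1 (lp_setD p_gt0 p_le1 (lpP _) _)); exact: lp_setZ.
exists (Sub l lin : lp); apply/cvgrPdist_le => e e0.
have [n0 hn0] := key e e0; exists n0 => // n /= hn.
rewrite sub0r normrN ger0_norm ?lp_norm_ge0//.
have [_] := lp_partial_bound (hn0 n hn).
have -> : val (u n) - l = val (u n - (Sub l lin : lp)) by [].
rewrite -lp_norm_powR leNgt => h; rewrite leNgt; apply/negP => h'.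
move/negP: h; apply; apply: (gt0_ltr_powR p_gt0) => //;
  by rewrite nnegrE ?lp_norm_ge0 ?ltW.
Qed.

Definition ellp : pBanach p :=
  @PBanach R p lp (@lp_norm R p p_gt0 p_le1) lp_norm_ge0 lp_norm_eq0 lp_normZ lp_normD lp_complete.

End lp_pBanach.

(* Main.v *)
Require Import Defs.
From HB Require Import structures.
From mathcomp Require Import all_boot all_order all_algebra.
From mathcomp Require Import all_classical all_reals all_analysis.
From mathcomp Require Import ring lra zify.
Import Order.TTheory GRing.Theory Num.Theory.
Import numFieldNormedType.Exports.
Set Implicit Arguments.
Unset Strict Implicit.
Unset Printing Implicit Defensive.
Local Open Scope classical_set_scope.
Local Open Scope ring_scope.
Local Open Scope quotient_scope.

(** The p-th power of the distance is a metric. A sequence of points x_n whose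
    distances to a point c of [M], or of a completion, grow or decrease fast enough
    satisfies d(x_n, x_{n+1})^p <= s |r(x_n) - r(x_{n+1})|, where
    s = t^p and r is the p-th power of the distance to c. Such a sequence exists
    when [M] is unbounded, and also when c is a limit point of the completion.

    Consider the molecules v_n = (delta x_n - delta x_{n+1}) / d(x_n, x_{n+1}). The
    p-th power of a p-norm being subadditive, a combination of molecules has norm at
    most the l_p norm of its coefficients. The converse estimate, up to the factor t,
    comes from a map of [M] into L_p of the half-line: it sends z to the indicator
    function of the interval [0, r(z)]. It is 1-Lipschitz, since the indicators of
    [0, a] and [0, b] are at distance |a - b|^(1/p), and, r being monotone along the
    sequence, the differences of the images of consecutive x_n have disjoint
    supports, with norms |r(x_n) - r(x_{n+1})|^(1/p). The map need not take its
    values in l_p itself: on a space such as the line with the distance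
    |a - b|^(1/p), for p < 1, all Lipschitz maps to l_p are constant.

    The estimate holds in the free space over [M] ([molecule_lower]), hence the
    canonical map L from the free space over N = {x_n} satisfies |w| <= t |L w| on
    finite combinations of molecules, and then everywhere, since every w is the sum of
    a series of molecules: the free space over N is an isomorphic copy of l_p with the
    molecules as unit vectors ([chain_free_lp]). Both constants are
    at most t, which is at most 2^(1/p-1) t because p <= 1.

    The curve of indicators is built in a reduced product of finite-dimensional
    l_p spaces ([disjoint_curve]), the elements of the k-th factor being seen as
    step functions on a grid that becomes finer with k. There, completeness
    is a diagonal argument ([limsup_complete]). *)

(** * Powers with a positive exponent *)

Section powR_order.
Context (R : realType) (p : R) (p_gt0 : 0 < p).
Implicit Types x y : R.

Lemma powR_inv x : 0 <= x -> (x `^ p^-1) `^ p = x.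
Proof. by move=> x0; rewrite -powRrM mulVf ?gt_eqF// powRr1. Qed.

Lemma powR_invr x : 0 <= x -> x^-1 `^ p = (x `^ p)^-1.
Proof. by move=> x0; rewrite -powR_inv1// -powRrM mulN1r powRN. Qed.

Lemma ler_powR2 x y : 0 <= x -> 0 <= y -> (x `^ p <= y `^ p) = (x <= y).
Proof.
move=> x0 y0; apply/idP/idP; last first.
  by move=> xy; apply: ge0_ler_powR; rewrite ?nnegrE// ltW.
by apply: contraTT; rewrite -!ltNge => yx; apply: gt0_ltr_powR; rewrite ?nnegrE.
Qed.

Lemma ltr_powR2 x y : 0 <= x -> 0 <= y -> (x `^ p < y `^ p) = (x < y).
Proof. by move=> x0 y0; rewrite !ltNge ler_powR2. Qed.

End powR_order.

(** * The Banach space of a complete seminorm *)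

(** The field [psn] is the p-th power of a p-seminorm: it is subadditive, while
    the seminorm itself is only quasi-subadditive. *)
Record pSeminorm (R : realType) (p : R) (V : lmodType R) := PSeminorm {
  psn :> V -> R;
  psn_ge0 : forall u, 0 <= psn u;
  psnZ : forall a u, psn (a *: u) = `|a| `^ p * psn u;
  psnD : forall u v, psn (u + v) <= psn u + psn v }.

Lemma psn0 (R : realType) (p : R) (V : lmodType R) (q : pSeminorm p V) :
  0 < p -> q 0 = 0.
Proof.
by move=> p_gt0; rewrite -(scale0r 0) psnZ normr0 powR0 ?mul0r// gt_eqF.
Qed.

Section separation.
Context (R : realType) (p : R) (p_gt0 : 0 < p) (V : lmodType R)
  (q : pSeminorm p V).
Implicit Types u v : V.

Let psnN u : q (- u) = q u.
Proof. by rewrite -scaleN1r psnZ normrN1 powR1 mul1r. Qed.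

(** The positivity of the exponent is an argument so that it can be recovered by
    unification when the closure of the kernel under subtraction is looked up. *)
Definition psn_null of 0 < p : {pred V} := fun u => q u == 0.

Lemma psn_null_zmod : zmod_closed (psn_null p_gt0).
Proof.
split=> [|u v]; rewrite !unfold_in ?(psn0 q p_gt0)// => /eqP u0 /eqP v0.
rewrite eq_le psn_ge0 andbT; apply: le_trans (psnD _ _ _) _.
by rewrite psnN u0 v0 addr0.
Qed.

HB.instance Definition _ :=
  GRing.isZmodClosed.Build V (psn_null p_gt0) psn_null_zmod.

Definition separated := {ideal_quot (psn_null p_gt0)}.

HB.instance Definition _ := GRing.Zmodule.on separated.
HB.instance Definition _ := EqQuotient.on separated.

Local Notation pi := (\pi_separated).

Lemma separated_eqP u v : (pi u == pi v) = (q (u - v) == 0).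
Proof. by rewrite -Quotient.idealrBE. Qed.

Let psn_eqmod u v : pi u = pi v -> q u = q v.
Proof.
have le x y : pi x = pi y -> q x <= q y.
  move/eqP; rewrite separated_eqP => /eqP xy.
  by rewrite -{1}(subrK y x) (le_trans (psnD _ _ _))// xy add0r.
by move=> uv; apply/eqP; rewrite eq_le !le.
Qed.

Lemma separated_piD u v : pi (u + v) = pi u + pi v.
Proof. by rewrite !piE. Qed.

Definition separated_scale (a : R) (x : separated) : separated :=
  pi (a *: repr x).

Lemma separated_piZ a u : pi (a *: u) = separated_scale a (pi u).
Proof.
apply/eqP; rewrite separated_eqP -scalerBr psnZ.
have /eqP := esym (reprK (pi u)).
by rewrite separated_eqP => /eqP ->; rewrite mulr0.
Qed.

Let scaleA a b x :
  separated_scale a (separated_scale b x) = separated_scale (a * b) x.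
Proof.
elim/quotW: x => u; rewrite -(separated_piZ b) -separated_piZ.
by rewrite -separated_piZ scalerA.
Qed.

Let scale1 : left_id 1 separated_scale.
Proof. by elim/quotW => u; rewrite -separated_piZ scale1r. Qed.

Let scaleDr : right_distributive separated_scale +%R.
Proof.
move=> a; elim/quotW => u; elim/quotW => v; rewrite -separated_piD.
by rewrite -3!separated_piZ -separated_piD scalerDr.
Qed.

Let scaleDl x : {morph separated_scale^~ x : a b / a + b}.
Proof.
move=> a b; elim/quotW: x => u; rewrite -3!separated_piZ.
by rewrite -separated_piD scalerDl.
Qed.

HB.instance Definition _ :=
  GRing.Zmodule_isLmodule.Build R separated scaleA scale1 scaleDr scaleDl.

Definition separated_norm (x : separated) : R := q (repr x) `^ p^-1.

Lemma separated_norm_pi u : separated_norm (pi u) `^ p = q u.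
Proof.
by rewrite powR_inv ?psn_ge0//; apply: psn_eqmod; rewrite reprK.
Qed.

Let norm_ge0 x : 0 <= separated_norm x. Proof. exact: powR_ge0. Qed.

Let norm_eq0 x : separated_norm x = 0 -> x = 0.
Proof.
rewrite -[x]reprK => /(congr1 (fun y => y `^ p)).
rewrite separated_norm_pi powR0 ?gt_eqF// => x0.
have -> : 0 = pi 0 :> separated by rewrite !piE.
by apply/eqP; rewrite separated_eqP subr0 x0.
Qed.

Let norm_Z a x : separated_norm (a *: x) = `|a| * separated_norm x.
Proof.
rewrite -[x]reprK -[a *: _]separated_piZ.
apply: (powR_injective p_gt0); rewrite ?nnegrE ?mulr_ge0//.
by rewrite powRM// !separated_norm_pi psnZ.
Qed.

Let norm_D x y : separated_norm (x + y) `^ p <=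
  separated_norm x `^ p + separated_norm y `^ p.
Proof.
by rewrite -[x]reprK -[y]reprK -separated_piD !separated_norm_pi psnD.
Qed.

Hypothesis psn_complete : forall u : nat -> V,
  (forall e, 0 < e -> exists n0, forall m n, (n0 <= m)%N -> (n0 <= n)%N ->
     q (u m - u n) < e) ->
  exists l, forall e, 0 < e -> exists n0, forall n, (n0 <= n)%N ->
     q (u n - l) <= e.

Let norm_complete (x : nat -> separated) :
  (forall e, 0 < e -> exists n0, forall m n, (n0 <= m)%N -> (n0 <= n)%N ->
     separated_norm (x m - x n) < e) ->
  exists l, (fun n => separated_norm (x n - l)) @ \oo --> 0.
Proof.
move=> cx; have [e e0|l hl] := @psn_complete (fun n => repr (x n)).
  have [n0 h] := cx (e `^ p^-1) (powR_gt0 _ e0); exists n0 => m n hm hn.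
  rewrite -separated_norm_pi -(powR_inv p_gt0 (ltW e0)) ltr_powR2 ?powR_ge0//.
  have -> : pi (repr (x m) - repr (x n)) = x m - x n; last exact: h.
  by rewrite -{2}(reprK (x m)) -{2}(reprK (x n)) !piE.
exists (pi l); apply/cvgrPdist_le => e e0.
have [n0 h] := hl (e `^ p) (powR_gt0 _ e0); exists n0 => // n /= /h.
rewrite sub0r normrN ger0_norm// -{2}(reprK (x n)).
have -> : pi (repr (x n)) - pi l = pi (repr (x n) - l) by rewrite !piE.
by rewrite -separated_norm_pi ler_powR2// ltW.
Qed.

Definition separated_pBanach : pBanach p :=
  PBanach norm_ge0 norm_eq0 norm_Z norm_D norm_complete.

End separation.

Lemma separated_quotient (R : realType) (p : R) (V : lmodType R)
    (q : pSeminorm p V) : 0 < p ->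
  (forall u : nat -> V,
    (forall e, 0 < e -> exists n0, forall m n, (n0 <= m)%N -> (n0 <= n)%N ->
       q (u m - u n) < e) ->
    exists l, forall e, 0 < e -> exists n0, forall n, (n0 <= n)%N ->
       q (u n - l) <= e) ->
  exists (X : pBanach p) (f : {linear V -> X}),
    forall u, pnorm (f u) `^ p = q u.
Proof.
move=> p_gt0 qc.
pose f : V -> separated_pBanach p_gt0 qc := \pi_(separated p_gt0 q).
have f_lin : linear f.
  by move=> a u v; rewrite /f separated_piD separated_piZ.
pose F := GRing.isLinear.Build _ _ _ _ f f_lin.
pose fL : {linear V -> separated_pBanach p_gt0 qc} :=
  HB.pack_for {linear V -> separated_pBanach p_gt0 qc} f F.
exists (separated_pBanach p_gt0 qc), fL.
exact: separated_norm_pi.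
Qed.

(** * Reduced products *)

(** Bounded sequences modulo those with upper limit 0. Completeness is automatic,
    whatever the factors are, since a diagonal sequence absorbs all the terms of a
    Cauchy sequence; this makes exact norms available from approximate ones. *)
Section reduced_product.
Context (R : realType) (p : R) (p_gt0 : 0 < p) (W : lmodType R)
  (q : nat -> pSeminorm p W).

Definition psn_bounded of 0 < p : {pred nat -> W} :=
  mem [set u : nat -> W | exists B, forall k, q k (u k) <= B].

Lemma psn_bounded_submod : submod_closed (psn_bounded p_gt0).
Proof.
split; first by apply/mem_set; exists 0 => k; rewrite (psn0 _ p_gt0).
move=> c u v /set_mem[B uB] /set_mem[D vD]; apply/mem_set.
exists (`|c| `^ p * B + D) => k; apply: le_trans (psnD _ _ _) _.
by rewrite lerD// psnZ ler_wpM2l// powR_ge0.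
Qed.

HB.instance Definition _ :=
  GRing.isSubmodClosed.Build R (nat -> W) (psn_bounded p_gt0)
    psn_bounded_submod.

Definition bounded_seq := {u : nat -> W | u \in psn_bounded p_gt0}.

HB.instance Definition _ := SubChoice.on bounded_seq.
HB.instance Definition _ := [SubChoice_isSubLmodule of bounded_seq by <:].

Implicit Types u v : bounded_seq.

Lemma bounded_seqP u : exists B, forall k, q k (val u k) <= B.
Proof. exact: set_mem (valP u). Qed.

Definition eventual_bounds u : set R :=
  [set c | exists K, forall k, (K <= k)%N -> q k (val u k) <= c].

(** The upper limit of the sequence [q k (u k)]. *)
Definition psn_limsup u : R := inf (eventual_bounds u).

Let bounds_ge0 u c : eventual_bounds u c -> 0 <= c.
Proof. by move=> [K /(_ K (leqnn _))]; apply: le_trans; exact: psn_ge0. Qed.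

Let bounds_n0 u : eventual_bounds u !=set0.
Proof. by have [B uB] := bounded_seqP u; exists B, 0%N. Qed.

Lemma psn_limsup_le u c :
  (exists K, forall k, (K <= k)%N -> q k (val u k) <= c) -> psn_limsup u <= c.
Proof. by move=> uc; apply: ge_inf => //; exists 0 => d /bounds_ge0. Qed.

Lemma psn_limsup_lt u c : psn_limsup u < c ->
  exists K, forall k, (K <= k)%N -> q k (val u k) < c.
Proof.
move=> /(inf_lt (bounds_n0 u))[d [K ud] dc]; exists K => k /ud.
by move=> /le_lt_trans; apply.
Qed.

Let limsup_ge0 u : 0 <= psn_limsup u.
Proof. by apply: lb_le_inf => // c /bounds_ge0. Qed.

Let limsupD u v : psn_limsup (u + v) <= psn_limsup u + psn_limsup v.
Proof.
apply/ler_addgt0Pr => e e0.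
have [K hK] := @psn_limsup_lt u (psn_limsup u + e / 2) ltac:(lra).
have [K' hK'] := @psn_limsup_lt v (psn_limsup v + e / 2) ltac:(lra).
apply: psn_limsup_le; exists (maxn K K') => k; rewrite geq_max => /andP[k1 k2].
apply: le_trans (psnD _ _ _) _.
by have := hK _ k1; have := hK' _ k2; lra.
Qed.

Let limsupZ_le a u : psn_limsup (a *: u) <= `|a| `^ p * psn_limsup u.
Proof.
have [->|a0] := eqVneq a 0.
  rewrite scale0r normr0 powR0 ?gt_eqF// mul0r; apply: psn_limsup_le.
  by exists 0%N => k _; rewrite (psn0 _ p_gt0).
have a_gt0 : 0 < `|a| `^ p by rewrite powR_gt0 ?normr_gt0.
apply/ler_addgt0Pr => e e0.
have [|K hK] := @psn_limsup_lt u (psn_limsup u + e / `|a| `^ p).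
  by rewrite ltrDl divr_gt0.
apply: psn_limsup_le; exists K => k /hK/ltW h.
rewrite [val _ k]/(a *: val u k) psnZ.
apply: le_trans (ler_wpM2l (ltW a_gt0) h) _.
by rewrite mulrDr mulrCA divff ?gt_eqF// mulr1.
Qed.

Let limsupZ a u : psn_limsup (a *: u) = `|a| `^ p * psn_limsup u.
Proof.
apply/eqP; rewrite eq_le limsupZ_le /=.
have [->|a0] := eqVneq a 0; first by rewrite normr0 powR0 ?mul0r ?gt_eqF.
have a_gt0 : 0 < `|a| `^ p by rewrite powR_gt0 ?normr_gt0.
rewrite mulrC -ler_pdivlMr// mulrC.
have := limsupZ_le a^-1 (a *: u); rewrite scalerA mulVf// scale1r.
by rewrite normfV powR_invr.
Qed.

Definition limsup_pSeminorm : pSeminorm p bounded_seq :=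
  PSeminorm limsup_ge0 limsupZ limsupD.

Lemma limsup_cvg u l : (fun k => q k (val u k)) @ \oo --> l ->
  psn_limsup u = l.
Proof.
move=> /cvgrPdist_lt ul; apply/eqP; rewrite eq_le; apply/andP; split.
  apply/ler_addgt0Pr => e e0; have [K _ hK] := ul e e0.
  by apply: psn_limsup_le; exists K => k /hK /=; rewrite ltr_norml; lra.
apply/ler_addgt0Pr => e e0.
have [K _ hK] := ul (e / 2) ltac:(lra).
have [K' hK'] := @psn_limsup_lt u (psn_limsup u + e / 2) ltac:(lra).
have := hK (maxn K K') (leq_maxl _ _); have := hK' _ (leq_maxr K K').
by rewrite /= ltr_norml; lra.
Qed.

(** Diagonal argument: pass to indices [m i] along which the sequence moves by at
    most [e i] afterwards. For each [i], almost every coordinate [k] already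
    sees these bounds up to [i], and the limit copies at [k] the last term for
    which it does. *)
Lemma limsup_complete (u : nat -> bounded_seq) :
  (forall e, 0 < e -> exists n0, forall m n, (n0 <= m)%N -> (n0 <= n)%N ->
     limsup_pSeminorm (u m - u n) < e) ->
  exists l, forall e, 0 < e -> exists n0, forall n, (n0 <= n)%N ->
     limsup_pSeminorm (u n - l) <= e.
Proof.
move=> cu; pose e i : R := i.+1%:R^-1.
have e_gt0 i : 0 < e i by rewrite invr_gt0 ltr0n.
have /choice[m0 hm0] : forall i, exists n0, forall m n,
    (n0 <= m)%N -> (n0 <= n)%N -> limsup_pSeminorm (u m - u n) < e i.
  by move=> i; exact: cu.
pose m i := (\max_(j < i.+1) m0 j)%N.
have m0_le j i : (j <= i)%N -> (m0 j <= m i)%N.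
  rewrite -ltnS => ji.
  exact: (@leq_bigmax _ (fun j : 'I_i.+1 => m0 j) (Ordinal ji)).
(* At coordinate k, the terms of index m 0, ..., m i are as close as they should
   be; d k is the largest such i up to k. *)
pose good k (i : nat) := [forall j : 'I_i.+1,
  q k (val (u (m j)) k - val (u (m i)) k) <= e j].
have good0 k : good k 0%N.
  apply/forallP => j; rewrite (ord1 j) subrr (psn0 _ p_gt0).
  exact: ltW.
pose d k : 'I_k.+1 := [arg max_(i > ord0 | good k i) (i : nat)].
have dP k : good k (d k) /\ forall i : 'I_k.+1, good k i -> (i <= d k)%N.
  by rewrite /d; case: arg_maxnP => // i gi hi; split.
have good_near i : exists K, forall k, (K <= k)%N -> good k i.
  have /choice[K hK] : forall j : 'I_i.+1, exists K, forall k, (K <= k)%N ->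
      q k (val (u (m j)) k - val (u (m i)) k) < e j.
    move=> j; apply: (@psn_limsup_lt (u (m j) - u (m i))).
    by apply: hm0; apply: m0_le; rewrite // -ltnS.
  exists (\max_j K j)%N => k hk; apply/forallP => j.
  by apply/ltW/hK/(leq_trans _ hk)/leq_bigmax.
pose w k := val (u (m (d k))) k.
have dist_w i k : (i <= d k)%N -> q k (val (u (m i)) k - w k) <= e i.
  by move=> id; have /forallP/(_ (Ordinal (id : (i < (d k).+1)%N))) := (dP k).1.
have w_in : w \in psn_bounded p_gt0.
  apply/mem_set; have [B uB] := bounded_seqP (u (m 0%N)).
  exists (e 0%N + B) => k.
  have -> : w k = (-1) *: (val (u (m 0%N)) k - w k) + val (u (m 0%N)) k.
    by rewrite scaleN1r opprB subrK.
  apply: le_trans (psnD _ _ _) _; rewrite lerD// psnZ normrN1 powR1 mul1r.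
  exact: dist_w.
exists (Sub w w_in : bounded_seq) => eps eps0.
have [i hi] : exists i, e i < eps / 2.
  have eps2 : 0 < eps / 2 by rewrite divr_gt0.
  have /cvgrPdist_lt/(_ _ eps2)[i _ hi] := @cvg_harmonic R.
  by exists i; have := hi i (leqnn i); rewrite /= sub0r normrN ger0_norm.
exists (m i) => n hn.
have -> : u n - (Sub w w_in : bounded_seq) =
    (u n - u (m i)) + (u (m i) - (Sub w w_in : bounded_seq)).
  by rewrite addrA subrK.
apply: le_trans (limsupD _ _) _.
have h1 : psn_limsup (u n - u (m i)) < e i.
  by apply: hm0; [apply: leq_trans hn|]; exact: m0_le.
suff : psn_limsup (u (m i) - (Sub w w_in : bounded_seq)) <= e i by lra.
have [K hK] := good_near i.
apply: psn_limsup_le; exists (maxn K i) => k; rewrite geq_max => /andP[Kk ik].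
apply: dist_w.
exact: (dP k).2 (Ordinal (ik : (i < k.+1)%N)) (hK k Kk).
Qed.

(** The sequences of interest have convergent norms, so that the upper limit need
    not appear in the conclusion. *)
Lemma reduced_product : exists (X : pBanach p) (f : {linear bounded_seq -> X}),
  forall u l, (fun k => q k (val u k)) @ \oo --> l -> pnorm (f u) `^ p = l.
Proof.
have [X [f hf]] := separated_quotient p_gt0 limsup_complete.
by exists X, f => u l /limsup_cvg <-; exact: hf.
Qed.

End reduced_product.

(** * The curve of initial intervals *)

(** In L_p of the half-line, the indicator functions of the intervals [0, s] form
    a curve with |s - s'| as the p-th power of the distance, and its increments
    over disjoint intervals have disjoint supports. The same curve is produced here
    in the reduced product of the spaces of step functions on finer and finer
    grids: the k-th one has mesh 1/(k+1) and covers [0, k+1], whence (k+1)^2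
    cells. *)
Section step_curve.
Context (R : realType) (p : R) (p_gt0 : 0 < p) (p_le1 : p <= 1).

Lemma powR_norm_sum_disjoint (x : nat -> R) n :
  (forall i j, (i < j)%N -> x i * x j = 0) ->
  `|\sum_(i < n) x i| `^ p = \sum_(i < n) `|x i| `^ p.
Proof.
move=> xx; elim: n => [|n IH].
  by rewrite !big_ord0 normr0 powR0// gt_eqF.
rewrite !big_ord_recr /=; have [->|xn0] := eqVneq (x n) 0.
  by rewrite normr0 powR0 ?gt_eqF// !addr0.
have x0 (i : 'I_n) : x i = 0.
  have /eqP := xx _ _ (ltn_ord i).
  by rewrite mulf_eq0 (negbTE xn0) orbF => /eqP.
rewrite [X in X + _]big1 => [|i _]; last exact: x0.
rewrite [X in _ = X + _]big1 ?add0r// => i _.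
by rewrite x0 normr0 powR0 ?gt_eqF.
Qed.

Local Notation mesh k := (k.+1%:R^-1 : R).

Definition grid_norm k (u : nat -> R) : R :=
  mesh k * \sum_(j < k.+1 ^ 2) `|u j| `^ p.

Let mesh_ge0 k : 0 <= mesh k. Proof. by rewrite invr_ge0. Qed.

Let grid_ge0 k u : 0 <= grid_norm k u.
Proof. by rewrite mulr_ge0// sumr_ge0// => j _; rewrite powR_ge0. Qed.

Let gridZ k a u : grid_norm k (a *: u) = `|a| `^ p * grid_norm k u.
Proof.
rewrite /grid_norm mulrCA; congr (_ * _); rewrite mulr_sumr.
by apply: eq_bigr => j _; rewrite -powRM// -normrM.
Qed.

Let gridD k u v : grid_norm k (u + v) <= grid_norm k u + grid_norm k v.
Proof.
rewrite -mulrDr ler_wpM2l// -big_split ler_sum// => j _.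
exact: (lp_powD p_gt0 p_le1 u v j).
Qed.

Definition grid_pSeminorm k : pSeminorm p (nat -> R) :=
  PSeminorm (@grid_ge0 k) (@gridZ k) (@gridD k).

Definition step (c : nat) : nat -> R := fun j => (j < c)%:R.

Lemma sum_step c n : \sum_(j < n) step c j = (minn c n)%:R.
Proof.
elim: n => [|n IH]; first by rewrite big_ord0 minn0.
by rewrite big_ord_recr /= IH /step -natrD; congr _%:R; lia.
Qed.

Lemma grid_step_diff k c d : (c <= k.+1 ^ 2)%N -> (d <= k.+1 ^ 2)%N ->
  grid_norm k (step c - step d) = `|mesh k * c%:R - mesh k * d%:R|.
Proof.
wlog cd : c d / (d <= c)%N.
  move=> H ck dk; have [dc|/ltnW cd] := leqP d c; first exact: H.
  rewrite distrC -H//; congr (_ * _); apply: eq_bigr => j _.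
  by rewrite !fctE distrC.
move=> ck dk; rewrite -mulrBr normrM (ger0_norm (mesh_ge0 k)); congr (_ * _).
rewrite ger0_norm ?subr_ge0 ?ler_nat//.
transitivity (\sum_(j < k.+1 ^ 2) (step c j - step d j)).
  apply: eq_bigr => j _; rewrite !fctE /step.
  case: ltnP => jc; case: ltnP => jd;
    rewrite ?subrr ?subr0 ?normr0 ?normr1 ?powR1 ?powR0 ?gt_eqF//.
  by have := leq_trans jd cd; rewrite ltnNge jc.
by rewrite sumrB !sum_step !(minn_idPl _).
Qed.

Definition cell (s : R) k := Num.trunc (s * k.+1%:R).

Lemma cell_le s k : (cell s k)%:R <= `|s| * k.+1%:R.
Proof.
have [s0|s0] := leP 0 s.
  by rewrite ger0_norm// truncn_le mulr_ge0.
rewrite /cell; suff -> : Num.trunc (s * k.+1%:R) = 0%N by rewrite mulr_ge0.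
by apply/truncn0Pn; rewrite -ltNge (@le_lt_trans _ _ 0)// mulr_le0_ge0// ltW.
Qed.

Lemma cell_cvg s : 0 <= s -> (fun k => mesh k * (cell s k)%:R) @ \oo --> s.
Proof.
move=> s0; apply/cvgrPdist_le => e e0.
have /cvgrPdist_le/(_ _ e0) := @cvg_harmonic R; apply: filterS => k /=.
rewrite sub0r normrN ger0_norm ?invr_ge0// => ke; apply: le_trans ke.
have k0 : 0 < k.+1%:R :> R by rewrite ltr0n.
have /andP[h1 h2] := truncn_itv (mulr_ge0 s0 (ltW k0)).
rewrite -/(cell s k) in h1 h2.
rewrite -[X in X - _](mulfK (lt0r_neq0 k0)) (mulrC _ _^-1) -mulrBr normrM.
rewrite ger0_norm ?invr_ge0// -[leRHS]mulr1 ler_wpM2l ?invr_ge0//.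
rewrite -(@natr1 _ (cell s k)) in h2; rewrite ler_norml; lra.
Qed.

Lemma step_disjoint (c : nat -> nat) j :
  {homo c : m n / (m <= n)%N} \/ {homo c : m n / (m <= n)%N >-> (n <= m)%N} ->
  forall i i', (i < i')%N ->
  (step (c i) - step (c i.+1)) j * (step (c i') - step (c i'.+1)) j = 0.
Proof.
move=> hc i i' ii'; rewrite !fctE /step.
have : ((c i <= c i.+1) && (c i.+1 <= c i') && (c i' <= c i'.+1))%N
    || ((c i'.+1 <= c i') && (c i' <= c i.+1) && (c i.+1 <= c i))%N.
  by apply/orP; case: hc => hc; [left|right]; rewrite 2?[X in X && _]hc ?hc.
case: (ltnP j (c i)); case: (ltnP j (c i.+1)); case: (ltnP j (c i'));
  case: (ltnP j (c i'.+1)); rewrite ?subrr ?mulr0 ?mul0r//; lia.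
Qed.

Lemma curve_in s :
  (fun k => step (cell s k)) \in psn_bounded grid_pSeminorm p_gt0.
Proof.
apply/mem_set; exists `|s| => k /=; rewrite /grid_norm.
rewrite mulrC ler_pdivrMr// (le_trans _ (cell_le s k))//.
apply: (@le_trans _ _ (\sum_(j < k.+1 ^ 2) step (cell s k) j)).
  apply: ler_sum => j _; rewrite /step; case: ltnP => _ /=.
    by rewrite normr1 powR1.
  by rewrite normr0 powR0// gt_eqF.
by rewrite sum_step ler_nat geq_minl.
Qed.

Definition curve s : bounded_seq p_gt0 grid_pSeminorm :=
  exist _ (fun k => step (cell s k)) (curve_in s).

Lemma grid_curve_cvg (r b : nat -> R) n : (forall i, 0 <= r i) ->
  {homo r : i j / (i <= j)%N >-> i <= j} \/
    {homo r : i j / (i <= j)%N >-> j <= i} ->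
  (fun k => grid_norm k
     (val (\sum_(i < n) b i *: (curve (r i) - curve (r i.+1))) k)) @ \oo -->
  \sum_(i < n) `|b i| `^ p * `|r i - r i.+1|.
Proof.
move=> r0 r_mono.
have H : (fun k => \sum_(i < n) `|b i| `^ p *
    `|mesh k * (cell (r i) k)%:R - mesh k * (cell (r i.+1) k)%:R|) @ \oo -->
    \sum_(i < n) `|b i| `^ p * `|r i - r i.+1|.
  apply: cvg_big => [|i _]; first exact: add_continuous.
  apply: cvgM; first exact: cvg_cst.
  by apply: cvg_norm; apply: cvgB; exact: cell_cvg.
apply: cvg_trans H; apply: near_eq_cvg.
near=> k.
have small i : (i <= n)%N -> (cell (r i) k <= k.+1 ^ 2)%N.
  move=> le_in; rewrite -(ler_nat R) (le_trans (cell_le _ _))// natrX expr2.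
  rewrite ler_wpM2r// ger0_norm//.
  apply: (@le_trans _ _ (\sum_(j < n.+1) r j)).
    by rewrite (bigD1 (Ordinal (le_in : (i < n.+1)%N)))//= lerDl sumr_ge0.
  rewrite (@le_trans _ _ k%:R) ?ler_nat//.
  by near: k; exact: nbhs_infty_ger.
transitivity (\sum_(i < n) grid_norm k
    (b i *: (step (cell (r i) k) - step (cell (r i.+1) k)))).
  by apply: eq_bigr => i _; rewrite gridZ grid_step_diff// small// ltnW.
rewrite raddf_sum fct_sumE /grid_norm -mulr_sumr exchange_big/=.
congr (_ * _); apply: eq_bigr => j _; rewrite fct_sumE.
symmetry; apply: (powR_norm_sum_disjoint
  (x := fun i => (b i *: (step (cell (r i) k) - step (cell (r i.+1) k))) j)).
move=> i i' ii'; rewrite [LHS](_ : _ = b i * b i' *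
   ((step (cell (r i) k) - step (cell (r i.+1) k)) j *
   (step (cell (r i') k) - step (cell (r i'.+1) k)) j)); last first.
  by rewrite !fctE; rewrite /GRing.scale/=; ring.
rewrite (@step_disjoint (fun i => cell (r i) k)) ?mulr0//.
case: r_mono => r_mono; [left|right] => m m' mm';
  by apply: le_truncn; rewrite ler_wpM2r// r_mono.
Unshelve. all: by end_near. Qed.

(** For [n = 1] this is the distance formula of the curve, so that its isometry
    and the disjointness of its increments have a single statement. *)
Lemma disjoint_curve : exists (X : pBanach p) (g : R -> X),
  forall (r b : nat -> R) n, (forall i, 0 <= r i) ->
  {homo r : i j / (i <= j)%N >-> i <= j} \/
    {homo r : i j / (i <= j)%N >-> j <= i} ->
  pnorm (\sum_(i < n) b i *: (g (r i) - g (r i.+1))) `^ p =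
  \sum_(i < n) `|b i| `^ p * `|r i - r i.+1|.
Proof.
have [X [f hf]] := reduced_product p_gt0 grid_pSeminorm.
exists X, (f \o curve) => r b n r0 r_mono.
rewrite -(hf _ _ (@grid_curve_cvg r b n r0 r_mono)) raddf_sum.
congr (pnorm _ `^ p); apply: eq_bigr => i _.
by symmetry; apply: etrans (linearZZ f _ _) _; rewrite raddfB.
Qed.

End step_curve.

(** * Limits in p-Banach spaces *)

Section pBanach_limits.
Context (R : realType) (p : R) (p_gt0 : 0 < p).
Implicit Types X Y : pBanach p.

Lemma pnorm0 X : pnorm (0 : X) = 0.
Proof. by rewrite -(scale0r 0) pnormZ normr0 mul0r. Qed.

Lemma pnormN X (x : X) : pnorm (- x) = pnorm x.
Proof. by rewrite -scaleN1r pnormZ normrN1 mul1r. Qed.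

Lemma pnorm_distC X (x y : X) : pnorm (x - y) = pnorm (y - x).
Proof. by rewrite -pnormN opprB. Qed.

Lemma pnorm_powZ X (a : R) (x : X) :
  pnorm (a *: x) `^ p = `|a| `^ p * pnorm x `^ p.
Proof. by rewrite pnormZ powRM// pnorm_ge0. Qed.

Lemma pnorm_pow_eq0 X (x : X) : pnorm x `^ p = 0 -> x = 0.
Proof. by move/powR_eq0_eq0/pnorm_eq0. Qed.

Lemma pnorm_pow_sum X I (s : seq I) (u : I -> X) :
  pnorm (\sum_(i <- s) u i) `^ p <= \sum_(i <- s) pnorm (u i) `^ p.
Proof.
elim/big_rec2: _ => [|i b x _ h]; first by rewrite pnorm0 powR0// gt_eqF.
by apply: le_trans (pnormD _ _) _; rewrite lerD2l.
Qed.

Lemma pnorm_le_pow X Y (c : R) (x : X) (y : Y) : 0 <= c ->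
  pnorm x `^ p <= c `^ p * pnorm y `^ p -> pnorm x <= c * pnorm y.
Proof.
move=> c0; rewrite -powRM ?pnorm_ge0// ler_powR2 ?pnorm_ge0//.
by rewrite mulr_ge0 ?pnorm_ge0.
Qed.

(** Convergence is measured by the p-th power of the norm, which satisfies the
    triangle inequality. *)
Definition pcvg X (u : nat -> X) l := forall e, 0 < e -> exists n0,
  forall n, (n0 <= n)%N -> pnorm (u n - l) `^ p < e.

Lemma pcauchy_pcvg X (u : nat -> X) :
  (forall e, 0 < e -> exists n0, forall m n, (n0 <= m)%N -> (m <= n)%N ->
     pnorm (u n - u m) `^ p < e) -> exists l, pcvg u l.
Proof.
move=> cu; have [e e0|l hl] := @pban_complete _ _ X u.
  have [n0 h] := cu (e `^ p) (powR_gt0 _ e0); exists n0 => m n hm hn.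
  rewrite -(ltr_powR2 p_gt0) ?pnorm_ge0// ?(ltW e0)//.
  have [mn|/ltnW nm] := leqP m n; last exact: h.
  by rewrite pnorm_distC; exact: h.
exists l => e e0.
have /cvgrPdist_lt/(_ _ (powR_gt0 p^-1 e0))[n0 _ h] := hl; exists n0 => n /h /=.
rewrite sub0r normrN ger0_norm ?pnorm_ge0// => h'.
by rewrite -(powR_inv p_gt0 (ltW e0)) ltr_powR2 ?pnorm_ge0 ?powR_ge0.
Qed.

Lemma pcvg_unique X (u : nat -> X) l l' : pcvg u l -> pcvg u l' -> l = l'.
Proof.
move=> ul ul'; apply/eqP; rewrite -subr_eq0; apply/eqP/pnorm_pow_eq0.
apply/eqP; rewrite eq_le powR_ge0 andbT; apply/ler_addgt0Pr => e e0.
have [n h] := ul (e / 2) ltac:(lra); have [n' h'] := ul' (e / 2) ltac:(lra).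
have := h (maxn n n') (leq_maxl _ _); have := h' (maxn n n') (leq_maxr _ _).
set z := u _ => h1 h2; have -> : l - l' = (l - z) + (z - l').
  by rewrite addrA subrK.
by apply: le_trans (pnormD _ _) _; rewrite (pnorm_distC l); lra.
Qed.

Lemma pcvg_linear X (a : R) (u v : nat -> X) l m : pcvg u l -> pcvg v m ->
  pcvg (fun n => a *: u n + v n) (a *: l + m).
Proof.
move=> ul vm e e0; have a1 : 0 < `|a| `^ p + 1 by rewrite ltr_wpDl ?powR_ge0.
have [n h] := ul (e / 2 / (`|a| `^ p + 1)) ltac:(by rewrite !divr_gt0).
have [n' h'] := vm (e / 2) ltac:(by rewrite divr_gt0).
exists (maxn n n') => k; rewrite geq_max => /andP[/h hk /h' hk'].
rewrite opprD addrACA -scalerBr; apply: le_lt_trans (pnormD _ _) _.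
rewrite pnorm_powZ; move: hk; rewrite ltr_pdivlMr// mulrDr mulr1 => hk.
have := powR_ge0 (pnorm (u k - l)) p; nra.
Qed.

Lemma pcvg_bounded X Y (T : {linear X -> Y}) (c : R) (u : nat -> X) l :
  0 <= c -> (forall x, pnorm (T x) <= c * pnorm x) -> pcvg u l ->
  pcvg (T \o u) (T l).
Proof.
move=> c0 Tc ul e e0; have c1 : 0 < c `^ p + 1 by rewrite ltr_wpDl ?powR_ge0.
have [n h] := ul (e / (c `^ p + 1)) ltac:(by rewrite divr_gt0).
exists n => k /h; rewrite ltr_pdivlMr// mulrDr mulr1 /= -raddfB => hk.
apply: (@le_lt_trans _ _ (c `^ p * pnorm (u k - l) `^ p)); last first.
  by have := powR_ge0 (pnorm (u k - l)) p; lra.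
by rewrite -powRM ?pnorm_ge0// ler_powR2 ?mulr_ge0 ?pnorm_ge0 ?Tc.
Qed.

Lemma pcvg_ge X Y (c B : R) (u : nat -> X) l (v : nat -> Y) m : 0 <= c ->
  pcvg u l -> pcvg v m ->
  (forall n, pnorm (u n) `^ p <= c * pnorm (v n) `^ p + B) ->
  pnorm l `^ p <= c * pnorm m `^ p + B.
Proof.
move=> c0 ul vm uv; apply/ler_addgt0Pr => e e0.
have c1 : 0 < c + 1 by lra.
have [n h] := ul (e / 2) ltac:(by rewrite divr_gt0).
have [n' h'] := vm (e / 2 / (c + 1)) ltac:(by rewrite !divr_gt0).
have := h (maxn n n') (leq_maxl _ _); have := h' (maxn n n') (leq_maxr _ _).
move: (maxn n n') => k; rewrite ltr_pdivlMr// => h1 h2.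
have h3 := pnormD (l - u k) (u k); rewrite subrK pnorm_distC in h3.
have h4 := pnormD (v k - m) m; rewrite subrK in h4.
have h5 := ler_wpM2l c0 h4; have h6 := powR_ge0 (pnorm (v k - m)) p.
have := uv k; nra.
Qed.

End pBanach_limits.

(** * Operators on free spaces *)

Section operator_norms.
Context (R : realType) (p : R) (p_gt0 : 0 < p).
Implicit Types X Y F : pBanach p.

Lemma opnorm_ub X Y (T : {linear X -> Y}) x :
  bounded_op T -> pnorm x <= 1 -> pnorm (T x) <= opnorm T.
Proof.
move=> [K TK] x1; apply: ub_le_sup; last by exists x.
exists `|K| => _ [z [_ z1] <-]; apply: le_trans (TK z I) _.
apply: le_trans (ler_wpM2r (pnorm_ge0 z) (ler_norm K)) _.
by rewrite -[leRHS]mulr1 ler_wpM2l.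
Qed.

Lemma opnorm_ge0 X Y (T : {linear X -> Y}) : bounded_op T -> 0 <= opnorm T.
Proof.
move=> Tb; have := opnorm_ub (x := 0) Tb; rewrite linear0 !pnorm0; apply.
exact: ler01.
Qed.

Lemma pnorm_le_opnorm X Y (T : {linear X -> Y}) x :
  bounded_op T -> pnorm (T x) <= opnorm T * pnorm x.
Proof.
move=> Tb; have [x0|x0] := eqVneq (pnorm x) 0.
  by rewrite (pnorm_eq0 x0) raddf0 !pnorm0 mulr0.
have xgt0 : 0 < pnorm x by rewrite lt0r x0 pnorm_ge0.
rewrite -ler_pdivrMr// mulrC -[(pnorm x)^-1]ger0_norm ?invr_ge0 ?pnorm_ge0//.
rewrite -pnormZ -linearZ; apply: opnorm_ub => //.
by rewrite pnormZ ger0_norm ?invr_ge0 ?pnorm_ge0// mulVf.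
Qed.

Lemma opnorm_on_le X Y (A : set X) (T : X -> Y) (c : R) : 0 <= c -> A 0 ->
  (forall x, A x -> pnorm (T x) <= c * pnorm x) -> opnorm_on A T <= c.
Proof.
move=> c0 A0 Tc; apply: ge_sup.
  by exists (pnorm (T 0)), 0 => //; split=> //; rewrite pnorm0.
move=> _ [x [Ax x1] <-]; apply: le_trans (Tc x Ax) _.
by rewrite -[leRHS]mulr1 ler_wpM2l.
Qed.

Lemma Lip_le (M : pMetric p) X (f : M -> X) (c : R) : 0 <= c ->
  (forall x y, pnorm (f x - f y) <= c * pdist x y) -> Lip f <= c.
Proof.
move=> c0 fc; rewrite /Lip; set A := (X in sup X).
have [->|A0] := eqVneq A set0; first by rewrite sup0.
apply: ge_sup; first exact/set0P.
move=> _ [[x y] /= xy <-]; rewrite ler_pdivrMr// lt0r pdist_ge0 andbT.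
by apply/negP => /eqP/pdist_eq0.
Qed.

Lemma free_extension (M : pMetric p) (o : M) F (delta : M -> F) X (f : M -> X)
    (c : R) : is_free_pspace o delta -> 0 <= c ->
  (forall x y, pnorm (f x - f y) <= c * pdist x y) -> f o = 0 ->
  exists T : {linear F -> X},
    (forall x, T (delta x) = f x) /\ (forall z, pnorm (T z) <= c * pnorm z).
Proof.
move=> [_ _ univ] c0 fc fo.
have [|T [Tb Td Tn _]] := univ X f _ fo; first by exists c.
exists T; split=> // z; apply: le_trans (pnorm_le_opnorm z Tb) _.
by rewrite ler_wpM2r ?pnorm_ge0// Tn Lip_le.
Qed.

(** The composite of an operator with [delta] is Lipschitz, so that uniqueness in
    the universal property makes bounded operators equal once they agree on the
    points. *)
Lemma free_ext_eq (M : pMetric p) (o : M) F (delta : M -> F) X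
    (T T' : {linear F -> X}) : is_free_pspace o delta ->
  bounded_op T -> bounded_op T' ->
  (forall x, T (delta x) = T' (delta x)) -> T =1 T'.
Proof.
move=> [iso delta0 univ] Tb T'b TT'.
have [||U [_ _ _ U_uniq]] := univ X (T \o delta).
- have [K TK] := Tb; exists K => x y /=.
  by rewrite -raddfB -iso; exact: TK.
- by rewrite /= delta0 raddf0.
by move=> z; rewrite (U_uniq T)// (U_uniq T')// => x; rewrite -TT'.
Qed.

End operator_norms.

(** * The sequence space: truncations and series of vectors *)

Section lp_synthesis.
Context (R : realType) (p : R) (p_gt0 : 0 < p) (p_le1 : p <= 1).
Local Notation lp := (ellp p_gt0 p_le1).
Implicit Types (a : lp) (b : nat -> R).

Definition lp_coord (a : lp) : nat -> R := val (a : lp_type p_gt0 p_le1).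

Let powR_norm0 : `|0 : R| `^ p = 0. Proof. by rewrite normr0 powR0 ?gt_eqF. Qed.

Let lp_summable a : lp_set p (lp_coord a). Proof. exact: lpP. Qed.
Arguments lp_summable : clear implicits.

Definition cut b n : nat -> R := fun k => if (k < n)%N then b k else 0.

Lemma series_cut b n K :
  series (lp_pow p (cut b n)) K = \sum_(k < minn K n) `|b k| `^ p.
Proof.
rewrite /series/= big_mkord.
elim: K => [|K IH]; first by rewrite min0n !big_ord0.
rewrite big_ord_recr/= IH /lp_pow /cut; case: ifPn => [Kn|].
  by rewrite (minn_idPl (ltnW Kn)) (minn_idPl Kn) big_ord_recr.
rewrite -leqNgt => Kn.
by rewrite powR_norm0 addr0 (minn_idPr Kn) (minn_idPr (leqW Kn)).
Qed.

Lemma cut_in b n : cut b n \in lp_pred p_gt0 p_le1.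
Proof.
suff bd K : series (lp_pow p (cut b n)) K <= \sum_(k < n) `|b k| `^ p.
  exact/mem_set/(proj1 (lp_partial_bound bd)).
rewrite series_cut; have [Kn|nK] := boolP (K <= n)%N; last first.
  by rewrite (minn_idPr _)// ltnW// ltnNge.
rewrite (minn_idPl Kn) (big_ord_widen n (fun k => `|b k| `^ p) Kn).
by rewrite [leRHS](bigID (fun i : 'I_n => (i < K)%N))/= lerDl sumr_ge0.
Qed.

Definition lp_cut b n : lp := exist _ (cut b n) (cut_in b n).

Lemma lp_ext (a a' : lp) : (forall k, lp_coord a k = lp_coord a' k) -> a = a'.
Proof. by move=> aa'; apply/val_inj/funext. Qed.

Lemma pnorm_lp a : pnorm a `^ p = limn (series (lp_pow p (lp_coord a))).
Proof. exact: lp_norm_powR. Qed.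

Lemma pnorm_cut b n : pnorm (lp_cut b n) `^ p = \sum_(k < n) `|b k| `^ p.
Proof.
rewrite pnorm_lp; apply: cvg_lim => //; apply: cvg_near_cst.
by exists n => // K /= nK; rewrite series_cut (minn_idPr nK).
Qed.

Lemma sum_le_lp a n : \sum_(k < n) `|lp_coord a k| `^ p <= pnorm a `^ p.
Proof.
rewrite pnorm_lp; apply: (le_trans _ (lp_partial_le n (lp_summable a))).
by rewrite /series/= big_mkord.
Qed.

Lemma cut_tail a n :
  pnorm (lp_cut (lp_coord a) n - a) `^ p + \sum_(k < n) `|lp_coord a k| `^ p
    <= pnorm a `^ p.
Proof.
rewrite -lerBrDr pnorm_lp; apply: (proj2 (lp_partial_bound _)) => K.
rewrite lerBrDr; apply: (le_trans _ (sum_le_lp a (maxn K n))).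
rewrite /series/= big_mkord; elim: K => [|K IH].
  by rewrite big_ord0 add0r max0n.
rewrite big_ord_recr/= {2}/lp_pow.
have -> : lp_coord (lp_cut (lp_coord a) n - a) K =
    if (K < n)%N then 0 else - lp_coord a K.
  transitivity (cut (lp_coord a) n K - lp_coord a K) => //.
  by rewrite /cut; case: ifP => _; rewrite ?subrr ?sub0r.
case: ifPn => [Kn|].
  rewrite powR_norm0 addr0 (le_trans IH)//.
  by rewrite (maxn_idPr (ltnW Kn)) (maxn_idPr Kn).
rewrite -leqNgt => Kn.
rewrite normrN addrAC (maxn_idPl (leqW Kn)) big_ord_recr/= lerD2r.
by rewrite (maxn_idPl Kn) in IH.
Qed.

Lemma cut_cvg a : pcvg (fun n => lp_cut (lp_coord a) n) a.
Proof.
move=> e e0; have /cvgrPdist_lt/(_ _ e0)[n0 _ h] := lp_summable a.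
exists n0 => n /h /=; rewrite -(pnorm_lp a) /series/= big_mkord.
by have := cut_tail a n; rewrite ltr_norml; lra.
Qed.

Lemma lp_tail_small a e : 0 < e -> exists n0, forall m n, (n0 <= m)%N ->
  (m <= n)%N -> \sum_(m <= k < n) `|lp_coord a k| `^ p < e.
Proof.
move=> e0; have /cvgrPdist_lt/(_ _ e0)[n0 _ h] := lp_summable a.
exists n0 => m n /h /= + mn; rewrite -(pnorm_lp a) /series/=.
have := sum_le_lp a n.
rewrite -(big_mkord xpredT (fun k => `|lp_coord a k| `^ p)).
rewrite (big_cat_nat (leq0n m) mn)/= ltr_norml /lp_pow; lra.
Qed.

Context (X : pBanach p) (v : nat -> X) (v1 : forall i, pnorm (v i) <= 1).

Definition lp_partial a n : X := \sum_(i < n) lp_coord a i *: v i.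

Let term_le a i : pnorm (lp_coord a i *: v i) `^ p <= `|lp_coord a i| `^ p.
Proof.
rewrite pnorm_powZ// -[leRHS]mulr1 ler_wpM2l ?powR_ge0//.
have -> : 1 = 1 `^ p :> R by rewrite powR1.
by rewrite ler_powR2 ?pnorm_ge0.
Qed.

Lemma lp_partial_norm a n :
  pnorm (lp_partial a n) `^ p <= \sum_(i < n) `|lp_coord a i| `^ p.
Proof.
by apply: le_trans (pnorm_pow_sum p_gt0 _ _) _; apply: ler_sum => i _.
Qed.

(** Subadditivity of the p-th power of the norm makes the series of an l_p sequence
    converge against any vectors of the unit ball, with norm at most that of the
    sequence. *)
Lemma lp_synthesis : exists S : {linear lp -> X},
  (forall a, pcvg (lp_partial a) (S a)) /\
  (forall a, pnorm (S a) <= pnorm a).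
Proof.
have /choice[S S_cvg] : forall a, exists l, pcvg (lp_partial a) l.
  move=> a; apply: (pcauchy_pcvg p_gt0) => e e0.
  have [n0 h] := lp_tail_small a e0; exists n0 => m n hm mn.
  apply: (le_lt_trans _ (h m n hm mn)); rewrite /lp_partial.
  rewrite -!(big_mkord xpredT (fun i => lp_coord a i *: v i)).
  rewrite (big_cat_nat (leq0n m) mn)/= addrAC subrr add0r.
  by apply: le_trans (pnorm_pow_sum p_gt0 _ _) _; apply: ler_sum => i _.
have S_lin : linear S.
  move=> c a a'; apply: (pcvg_unique (S_cvg _)).
  have := pcvg_linear c (S_cvg a) (S_cvg a').
  congr pcvg; apply/funext => n; rewrite /lp_partial scaler_sumr -big_split.
  by apply: eq_bigr => i _ /=; rewrite scalerA -scalerDl.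
exists (HB.pack_for {linear lp -> X} S (GRing.isLinear.Build _ _ _ _ S S_lin)).
split=> // a; rewrite -(ler_powR2 p_gt0 (pnorm_ge0 _) (pnorm_ge0 a)).
rewrite -[leRHS]add0r -(mul0r (pnorm (S a) `^ p)).
apply: (pcvg_ge (lexx 0) (S_cvg a) (S_cvg a)) => n.
by rewrite mul0r add0r (le_trans (lp_partial_norm a n))// sum_le_lp.
Qed.

End lp_synthesis.

(** * Chains: existence *)

Section chains.
Context (R : realType) (p : R) (p_gt0 : 0 < p) (p_le1 : p <= 1).
Implicit Types M C : pMetric p.

(** Along the sequence, distances are accounted for, up to the factor [s], by the
    variation of a single function that is 1-Lipschitz for the p-th power of the
    distance. Composed with the curve of initial intervals, this function turns the
    steps of the sequence into vectors with disjoint supports, whose norms to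
    the power p are right up to the factor [s]. *)
Record is_chain M (r : M -> R) (x : nat -> M) (s : R) : Prop := IsChain {
  chain_ge0 : forall z, 0 <= r z;
  chain_lip : forall z w, `|r z - r w| <= pdist z w `^ p;
  chain_mono : {homo r \o x : i j / (i < j)%N >-> i < j} \/
    {homo r \o x : i j / (i < j)%N >-> j < i};
  chain_gap : forall n, pdist (x n) (x n.+1) `^ p <=
    s * `|r (x n) - r (x n.+1)| }.

(** The functions [r] are distances, to the power p, to a point [c] of an isometric
    extension [C]. As the distance of two points is at most the sum of their radii,
    a sequence is a chain once its radii grow, or decrease, at the geometric rate
    (s + 1) / (s - 1): this is when the sum of two consecutive radii is at most [s]
    times their difference. *)
Section radius.
Context M C (i : M -> C) (c : C) (s : R).
Hypotheses (i_iso : forall x y, pdist (i x) (i y) = pdist x y) (s_gt1 : 1 < s).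

Let r (z : M) : R := pdist (i z) c `^ p.

Let radius_ge0 z : 0 <= r z. Proof. exact: powR_ge0. Qed.

Let radius_lip z w : `|r z - r w| <= pdist z w `^ p.
Proof.
have := pdist_triangle (i z) c (i w); have := pdist_triangle (i w) c (i z).
by rewrite (pdistC (i w) (i z)) i_iso -/(r z) -/(r w) ler_norml; lra.
Qed.

Let radius_sum z w : pdist z w `^ p <= r z + r w.
Proof.
by rewrite -i_iso /r (pdistC (i w) c); exact: pdist_triangle.
Qed.

Let gap_lt a b : 0 < a -> (s + 1) * a <= (s - 1) * b -> a < b.
Proof.
move=> a0 ab; have s1 : 0 < s - 1 by rewrite subr_gt0.
by rewrite -(ltr_pM2l s1) (lt_le_trans _ ab)// ltr_pM2r//; lra.
Qed.

Let gap_sum a b : (s + 1) * a <= (s - 1) * b -> a + b <= s * (b - a).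
Proof. by lra. Qed.

Let radius_chain (x : nat -> M) : (forall n, 0 < r (x n)) ->
  (forall n, (s + 1) * r (x n) <= (s - 1) * r (x n.+1)) \/
  (forall n, (s + 1) * r (x n.+1) <= (s - 1) * r (x n)) ->
  is_chain r x s.
Proof.
move=> x_gt0 gap; split=> //.
  case: gap => gap; [left|right]; apply: homo_ltn.
  - by move=> b a d; exact: lt_trans.
  - by move=> n; exact: gap_lt (gap n).
  - by move=> b a d ba db; exact: lt_trans db ba.
  - by move=> n; exact: gap_lt (gap n).
move=> n; apply: le_trans (radius_sum _ _) _; case: gap => /(_ n) gap.
  have h := gap_lt (x_gt0 n) gap.
  by rewrite distrC ger0_norm ?gap_sum// subr_ge0 ltW.
have h := gap_lt (x_gt0 n.+1) gap.
by rewrite ger0_norm ?subr_ge0 ?(ltW h)// addrC gap_sum.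
Qed.

Lemma chain_of_large_radii : (forall K, exists z, K < pdist (i z) c) ->
  exists r x, @is_chain M r x s.
Proof.
move=> large; have big K : exists z, K < r z.
  have [z hz] := large (`|K| `^ p^-1); exists z.
  apply: le_lt_trans (ler_norm K) _.
  by rewrite -(powR_inv p_gt0 (normr_ge0 K)) ltr_powR2 ?powR_ge0 ?pdist_ge0.
have s1 : 0 < s - 1 by rewrite subr_gt0.
have /choice[f hf] : forall z : {z | 0 < r z}, exists w : {z | 0 < r z},
    (s + 1) * r (sval z) <= (s - 1) * r (sval w).
  move=> [z z0]; have [w] := big ((s + 1) * r z / (s - 1)).
  rewrite ltr_pdivrMr// => hw; have w0 : 0 < r w.
    rewrite -(pmulr_lgt0 _ s1) (lt_trans _ hw)// mulr_gt0// addr_gt0//.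
    exact: lt_trans s_gt1.
  by exists (exist _ w w0) => /=; lra.
have [z0 hz0] := big 0.
exists r, (fun n => sval (iter n f (exist _ z0 hz0))); apply: radius_chain.
  by move=> n; case: (iter _ _ _).
by left=> n; exact: hf.
Qed.

Lemma chain_of_small_radii :
  (forall e, 0 < e -> exists z, 0 < pdist (i z) c < e) ->
  exists r x, @is_chain M r x s.
Proof.
move=> small; have tiny e : 0 < e -> exists z, 0 < r z < e.
  move=> e0; have [z /andP[z0 ze]] := small _ (powR_gt0 p^-1 e0); exists z.
  rewrite powR_gt0//= -(powR_inv p_gt0 (ltW e0)).
  by rewrite ltr_powR2 ?powR_ge0 ?pdist_ge0.
have s1 : 0 < s + 1 by rewrite addr_gt0 ?(lt_trans ltr01 s_gt1).
have /choice[f hf] : forall z : {z | 0 < r z}, exists w : {z | 0 < r z},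
    (s + 1) * r (sval w) <= (s - 1) * r (sval z).
  move=> [z z0]; have [|w] := tiny ((s - 1) * r z / (s + 1)).
    by rewrite divr_gt0// mulr_gt0// subr_gt0.
  rewrite ltr_pdivlMr// => /andP[w0 hw].
  by exists (exist _ w w0) => /=; lra.
have [z0 /andP[hz0 _]] := tiny 1 ltr01.
exists r, (fun n => sval (iter n f (exist _ z0 hz0))); apply: radius_chain.
  by move=> n; case: (iter _ _ _).
by right=> n; exact: hf.
Qed.

End radius.

(** If [x] and [y] are far apart, at least one of them is far from [c]. *)
Lemma unbounded_chain M (s : R) : 1 < s -> punbounded M ->
  exists r x, @is_chain M r x s.
Proof.
move=> s1 unb; have [c _] := unb 0.
apply: (@chain_of_large_radii M M id c s) => // K.
(* The triangle inequality for p-th powers gives one of x and y a radius above B. *)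
pose B : R := `|K| + 1; have B0 : 0 <= B by rewrite addr_ge0.
have [x [y xy]] := unb ((2 * B `^ p) `^ p^-1).
have {}xy : 2 * B `^ p < pdist x y `^ p.
  have h : 0 <= 2 * B `^ p by rewrite mulr_ge0 ?powR_ge0.
  by rewrite -(powR_inv p_gt0 h) ltr_powR2 ?powR_ge0 ?pdist_ge0.
have := pdist_triangle x y c; rewrite (pdistC c y) => tri.
have KB z : B `^ p < pdist z c `^ p -> K < pdist z c.
  by rewrite ltr_powR2 ?pdist_ge0// /B; have := ler_norm K; lra.
have [h|h] := ltP (B `^ p) (pdist x c `^ p); first by exists x; exact: KB.
by exists y; apply: KB; lra.
Qed.

(** A limit point [c] of the completion is approached by points [y] of the
    completion other than [c], and a point of [M] closer to [y] than [c] is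
    remains distinct from [c]. *)
Lemma limit_point_chain M (s : R) : 1 < s -> completion_has_limit_point M ->
  exists r x, @is_chain M r x s.
Proof.
move=> s1 [C [i [[_ iso dense] [c lim]]]].
apply: (@chain_of_small_radii M C i c s) => // e e0.
pose e' := (e `^ p / 2) `^ p^-1.
have ep : 0 < e `^ p / 2 by rewrite divr_gt0// powR_gt0.
(* For z closer to y than c is, the p-th power of the distance to c at most
   doubles from y to z, whence the division by 2. *)
have [y [yc cy]] := lim e' (powR_gt0 _ ep).
have cy0 : 0 < pdist c y.
  by rewrite lt0r pdist_ge0 andbT; apply/eqP => /pdist_eq0 /esym.
have [z zy] := dense y _ cy0.
have zyp : pdist (i z) y `^ p < pdist c y `^ p.
  by rewrite ltr_powR2 ?pdist_ge0.
have cyp : pdist c y `^ p < e `^ p / 2.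
  by rewrite -(powR_inv p_gt0 (ltW ep)) ltr_powR2 ?pdist_ge0 ?powR_ge0.
exists z; apply/andP; split.
  rewrite lt0r pdist_ge0 andbT; apply/eqP => /pdist_eq0 zc.
  by rewrite zc ltxx in zyp.
rewrite -(ltr_powR2 p_gt0) ?pdist_ge0 ?(ltW e0)//.
have := pdist_triangle (i z) c y; rewrite (pdistC y c); lra.
Qed.

(** * The norm of combinations of molecules *)

Section chain_theory.
Context M (r : M -> R) (x : nat -> M) (s : R) (ch : is_chain r x s).

Lemma chain_inj : injective x.
Proof.
move=> m n /(congr1 r) mn; have := chain_mono ch.
have [ltmn|ltmn|//] := ltngtP m n; case=> /(_ _ _ ltmn) /=;
  by rewrite mn ltxx.
Qed.

Lemma chain_dist_gt0 n : 0 < pdist (x n) (x n.+1).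
Proof.
rewrite lt0r pdist_ge0 andbT; apply/eqP => /pdist_eq0/chain_inj/eqP.
by rewrite ltn_eqF.
Qed.

Lemma chain_mono_le : {homo r \o x : i j / (i <= j)%N >-> i <= j} \/
  {homo r \o x : i j / (i <= j)%N >-> j <= i}.
Proof.
by case: (chain_mono ch) => h; [left|right] => m n;
  rewrite leq_eqVlt => /predU1P[->//|/h/ltW].
Qed.

Lemma chain_telescope m n : (m <= n)%N ->
  \sum_(m <= k < n) `|r (x k) - r (x k.+1)| = `|r (x m) - r (x n)|.
Proof.
move=> mn; case: chain_mono_le => h.
  rewrite distrC ger0_norm ?subr_ge0 ?(h m n)//.
  rewrite -(telescope_sumr (r \o x) mn); apply: eq_bigr => k _.
  by rewrite distrC ger0_norm// subr_ge0; exact: h.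
rewrite ger0_norm ?subr_ge0 ?(h m n)// -opprB.
rewrite -(telescope_sumr (r \o x) mn) -sumrN; apply: eq_bigr => k _.
by rewrite /= opprB ger0_norm// subr_ge0; exact: h.
Qed.

Lemma chain_const_ge0 : 0 <= s.
Proof.
have d0 := powR_gt0 p (chain_dist_gt0 0).
have := lt_le_trans d0 (chain_gap ch 0); rewrite pmulr_lgt0 => [/ltW//|].
by rewrite normr_gt0 subr_eq0; case: (chain_mono ch) => /(_ 0%N 1%N isT) /=;
  [move/lt_eqF->|move/gt_eqF->].
Qed.

Definition molecule (F : pBanach p) (delta : M -> F) (k : nat) : F :=
  (pdist (x k) (x k.+1))^-1 *: (delta (x k) - delta (x k.+1)).

(** The Lipschitz map [g \o r], for the curve [g], extends to an operator of norm
    at most 1 which sends the molecules to multiples of disjoint increments of the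
    curve, with p-th powers of norms at least 1 / s. *)
Lemma molecule_lower (o : M) (F : pBanach p) (delta : M -> F)
    (b : nat -> R) n : is_free_pspace o delta ->
  \sum_(k < n) `|b k| `^ p <=
  s * pnorm (\sum_(k < n) b k *: molecule delta k) `^ p.
Proof.
move=> free; have [X [g g_disjoint]] := disjoint_curve p_gt0 p_le1.
have g_iso u v : 0 <= u -> 0 <= v -> pnorm (g u - g v) `^ p = `|u - v|.
  move=> u0 v0.
  have := @g_disjoint (fun k => if k == 0%N then u else v) (fun=> 1) 1%N.
  rewrite !big_ord1 /= scale1r normr1 powR1 mul1r; apply.
    by move=> k; case: ifP.
  have [uv|/ltW vu] := leP u v; [left|right] => k l kl;
    by case: l kl => [|l]; case: k => [|k] //=.
have [||T [Td Tn]] := @free_extension _ _ M o F delta X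
    (fun z => g (r z) - g (r o)) 1 free ler01.
- move=> z w; rewrite opprB addrA subrK mul1r.
  rewrite -(ler_powR2 p_gt0) ?pnorm_ge0 ?pdist_ge0//.
  by rewrite g_iso ?(chain_ge0 ch)//; exact: (chain_lip ch).
- exact: subrr.
apply: (@le_trans _ _
    (s * pnorm (T (\sum_(k < n) b k *: molecule delta k)) `^ p)); last first.
  rewrite ler_wpM2l ?chain_const_ge0// ler_powR2 ?pnorm_ge0//.
  by rewrite -[leRHS]mul1r.
have -> : T (\sum_(k < n) b k *: molecule delta k) =
    \sum_(k < n) (b k / pdist (x k) (x k.+1)) *:
      (g ((r \o x) k) - g ((r \o x) k.+1)).
  rewrite linear_sum; apply: eq_bigr => k _.
  rewrite linearZZ /molecule linearZZ linearB !Td scalerA; congr (_ *: _).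
  by rewrite opprB addrA subrK.
rewrite (g_disjoint (r \o x) (fun k => b k / pdist (x k) (x k.+1)));
  [|by move=> k; exact: chain_ge0 ch _|exact: chain_mono_le].
rewrite mulr_sumr; apply: ler_sum => k _.
have dk := chain_dist_gt0 k; have dkp := powR_gt0 p dk.
have gap : 1 <= s * `|r (x k) - r (x k.+1)| / pdist (x k) (x k.+1) `^ p.
  by rewrite ler_pdivlMr// mul1r; exact: chain_gap ch k.
rewrite normrM powRM// normfV (ger0_norm (ltW dk)) powR_invr ?(ltW dk)//.
rewrite -[leLHS]mulr1 (le_trans (ler_wpM2l (powR_ge0 _ _) gap))//=.
by rewrite le_eqVlt; apply/orP; left; apply/eqP; ring.
Qed.

End chain_theory.

End chains.

(** * The free space over a chain *)

Section free_space_of_chain.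
Context (R : realType) (p : R) (p_gt0 : 0 < p) (p_le1 : p <= 1).
Local Notation lp := (ellp p_gt0 p_le1).
Context (N : pMetric p) (r : N -> R) (x : nat -> N) (s : R)
  (ch : is_chain r x s) (x_surj : forall z, exists n, x n = z).
Context (o : N) (F : pBanach p) (delta : N -> F)
  (free : is_free_pspace o delta).

Let d n : R := pdist (x n) (x n.+1).
Let d_neq0 n : d n != 0. Proof. exact: lt0r_neq0 (chain_dist_gt0 ch n). Qed.
Let s_ge0 : 0 <= s. Proof. exact: chain_const_ge0 ch. Qed.
Let t : R := s `^ p^-1.

Local Notation v := (molecule x delta).

Lemma pnorm_molecule n : pnorm (v n) = 1.
Proof.
have [iso _ _] := free; rewrite pnormZ iso ger0_norm ?invr_ge0 ?pdist_ge0//.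
exact: mulVf (d_neq0 n).
Qed.

Lemma sum_molecules n :
  \sum_(k < n) d k *: v k = delta (x 0%N) - delta (x n).
Proof.
elim: n => [|n IH]; first by rewrite big_ord0 subrr.
by rewrite big_ord_recr/= IH scalerA mulfV// scale1r addrA subrK.
Qed.

(** The increments of [n |-> lp_cut d n] are spread over the coordinates between
    two indices, so that the p-th power of the distance is a sum of gaps of the
    chain, which telescopes in terms of [r]. *)
Lemma cut_dist m n : pnorm (lp_cut p_gt0 p_le1 d m - lp_cut p_gt0 p_le1 d n)
  <= t * pdist (x m) (x n).
Proof.
wlog mn : m n / (m <= n)%N.
  by move=> H; have [/H//|/ltnW/H] := leqP m n; rewrite pnorm_distC pdistC.
rewrite pnorm_distC.
have -> : lp_cut p_gt0 p_le1 d n - lp_cut p_gt0 p_le1 d m =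
    lp_cut p_gt0 p_le1 (fun k => if (m <= k)%N then d k else 0) n.
  apply: lp_ext => k; transitivity (cut d n k - cut d m k) => //.
  rewrite /lp_coord/= /cut; case: ltnP => kn; case: ltnP => km //=;
    rewrite ?subrr ?subr0//.
  by have := leq_ltn_trans (leq_trans mn kn) km; rewrite ltnn.
rewrite -(ler_powR2 p_gt0 (pnorm_ge0 _)) ?mulr_ge0 ?powR_ge0 ?pdist_ge0//.
rewrite pnorm_cut powRM ?powR_ge0 ?pdist_ge0// powR_inv//.
apply: le_trans (ler_wpM2l s_ge0 (chain_lip ch (x m) (x n))).
rewrite -(chain_telescope ch mn) mulr_sumr.
rewrite -(big_mkord xpredT (fun k => `|if (m <= k)%N then d k else 0| `^ p)).
rewrite (big_cat_nat (leq0n m) mn)/= big_nat big1 ?add0r; last first.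
  by move=> k /andP[_ km]; rewrite leqNgt km normr0 powR0 ?gt_eqF.
rewrite big_nat [leRHS]big_nat; apply: ler_sum => k /andP[mk _].
by rewrite mk ger0_norm ?pdist_ge0//; exact: chain_gap ch k.
Qed.

(** The synthesis operator [S] of the molecules has norm at most 1. Its inverse [U]
    is the extension of the map that sends [x n] to the sequence of minus the
    first [n] distances: this is what [S] forces, by [sum_molecules], and the map
    is Lipschitz by [cut_dist]. *)
Lemma chain_free_lp : exists (U : {linear F -> lp}) (S : {linear lp -> F}),
  [/\ cancel U S, cancel S U,
      (forall z, pnorm (U z) <= t * pnorm z),
      (forall a, pnorm (S a) <= pnorm a) &
      (forall a, pcvg (fun n => \sum_(k < n) lp_coord a k *: v k) (S a))].
Proof.
have /choice[idx idxK] := x_surj.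
have idx_x n : idx (x n) = n by apply: (chain_inj ch).
pose phi z : lp := - lp_cut p_gt0 p_le1 d (idx z).
have t_ge0 : 0 <= t by exact: powR_ge0.
have [||U [Ud Un]] := @free_extension _ _ N o F delta lp
    (fun z => phi z - phi o) t free t_ge0.
- move=> z w; rewrite opprB addrA subrK /phi opprK addrC.
  by rewrite -{2}(idxK z) -{2}(idxK w) pdistC; exact: cut_dist.
- exact: subrr.
have v_le1 k : pnorm (v k) <= 1 by rewrite pnorm_molecule.
have [S [S_cvg Sn]] := lp_synthesis p_gt0 p_le1 v_le1.
have U_mol k : U (v k) = (d k)^-1 *:
    (lp_cut p_gt0 p_le1 d k.+1 - lp_cut p_gt0 p_le1 d k).
  rewrite /molecule linearZZ linearB !Ud opprB addrA subrK /phi !idx_x.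
  by rewrite opprK addrC.
have U_partial (a : lp) n : U (\sum_(k < n) lp_coord a k *: v k) =
    lp_cut p_gt0 p_le1 (lp_coord a) n.
  elim: n => [|n IH].
    by rewrite big_ord0 linear0; apply: lp_ext.
  rewrite big_ord_recr/= linearD IH linearZZ U_mol scalerA.
  apply: lp_ext => k; transitivity (cut (lp_coord a) n k +
    (lp_coord a n / d n) * (cut d n.+1 k - cut d n k)) => //.
  transitivity (cut (lp_coord a) n.+1 k) => //.
  rewrite /cut.
  have -> : (k < n.+1)%N = (k == n) || (k < n)%N by rewrite ltnS leq_eqVlt.
  have [->|kn] := eqVneq k n.
    by rewrite ltnn /= subr0 add0r divfK.
  by rewrite /=; case: ifP => _; rewrite !(subrr, mulr0, addr0).
have S_cut b n : S (lp_cut p_gt0 p_le1 b n) = \sum_(k < n) b k *: v k.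
  apply: (pcvg_unique (S_cvg _)) => e e0; exists n => K nK.
  have -> : lp_partial v (lp_cut p_gt0 p_le1 b n) K = \sum_(k < n) b k *: v k.
    rewrite /lp_partial (big_ord_widen K (fun k => b k *: v k) nK).
    rewrite [RHS]big_mkcond/=.
    apply: eq_bigr => k _; rewrite /lp_coord/= /cut.
    by case: ifP => //; rewrite scale0r.
  by rewrite subrr pnorm0 powR0// gt_eqF.
exists U, S; split=> //.
- move=> z; pose SU : {linear F -> F} := S \o U.
  have -> : S (U z) = SU z by [].
  rewrite -[RHS]/(idfun z); apply: (free_ext_eq free).
  + by exists t => w _; apply: le_trans (Sn _) (Un _).
  + by exists 1 => w _; rewrite mul1r.
  + move=> w; rewrite /SU/= Ud /phi opprK addrC linearB !S_cut !sum_molecules.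
    rewrite !idxK opprB addrC addrA subrK.
    by have [_ -> _] := free; rewrite subr0.
- move=> a.
  apply: (@pcvg_unique _ _ _ (fun n => lp_cut p_gt0 p_le1 (lp_coord a) n)).
    have := pcvg_bounded p_gt0 t_ge0 Un (S_cvg a).
    by congr pcvg; apply/funext => n /=; exact: U_partial.
  exact: cut_cvg.
Qed.

End free_space_of_chain.

Lemma chain_sub (R : realType) (p : R) (M : pMetric p) (A : set M) (r : M -> R)
    (y : nat -> sub_pMetric A) s :
  is_chain r (fun n => set_val (y n)) s ->
  is_chain (fun z : sub_pMetric A => r (set_val z)) y s.
Proof. by case=> r0 rlip rmono rgap; split. Qed.

Theorem theorem3p3 (R : realType) (p : R) (p_gt0 : 0 < p) (p_le1 : p <= 1)
    (M : pMetric p) (hM : punbounded M \/ completion_has_limit_point M)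
    (t : R) (t_gt1 : 1 < t) :
  exists N : set M,
    [/\ infinite_set N, countable N &
        forall (o : sub_pMetric N)
          (FN : pBanach p) (deltaN : sub_pMetric N -> FN)
          (FM : pBanach p) (deltaM : M -> FM),
          is_free_pspace o deltaN -> is_free_pspace (set_val o) deltaM ->
          C_isomorphic (2 `^ (p^-1 - 1) * t) FN (ellp p_gt0 p_le1) /\
          exists L : {linear FN -> FM},
            (forall x : sub_pMetric N, L (deltaN x) = deltaM (set_val x)) /\
            isomorphic_embedding (2 `^ (p^-1 - 1) * t) L].
Proof.
have t_ge0 : 0 <= t by rewrite ltW// (lt_trans ltr01).
have s_gt1 : 1 < t `^ p.
  have -> : 1 = 1 `^ p :> R by rewrite powR1.
  by rewrite ltr_powR2.
have tC : t <= 2 `^ (p^-1 - 1) * t.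
  rewrite -[leLHS]mul1r ler_wpM2r//.
  have e0 : 0 <= p^-1 - 1 by rewrite subr_ge0 invf_ge1.
  by have := ler_powR (ler1n R 2) e0; rewrite powRr0.
have [r [x ch]] : exists r x, @is_chain _ _ M r x (t `^ p).
  by case: hM; [exact: unbounded_chain | exact: limit_point_chain].
exists (range x); split.
- move=> /(finite_preimage (in2W (chain_inj ch))).
  by rewrite preimage_range; exact: infinite_nat.
- exact: card_image_le.
move=> o FN deltaN FM deltaM freeN freeM.
pose y n : sub_pMetric (range x) := SigSub (mem_set (imageT x n)).
have y_surj z : exists n, y n = z.
  by case: z => z hz; have [n _ xn] := set_mem hz; exists n; exact: val_inj.
have chN : is_chain (fun z : sub_pMetric (range x) => r (set_val z)) y (t `^ p).
  exact: chain_sub.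
have [U [S [US SU Un Sn S_cvg]]] := chain_free_lp p_gt0 p_le1 chN y_surj freeN.
rewrite -powRrM mulfV ?gt_eqF// powRr1// in Un.
have Ub : bounded_op U by exists t => z _.
have Sb : bounded_op S by exists 1 => z _; rewrite mul1r.
split.
  exists U, S; split=> //; apply: le_trans tC; rewrite -[leRHS]mulr1.
  apply: ler_pM; [exact: opnorm_ge0 | exact: opnorm_ge0 | |];
    apply: opnorm_on_le => // z _.
  by rewrite mul1r.
have [||L [Ld Ln]] := @free_extension _ _ _ o FN deltaN FM
    (fun z => deltaM (set_val z)) 1 freeN ler01.
- by move=> z w; have [-> _ _] := freeM; rewrite mul1r.
- by have [_ + _] := freeM.
have L_mol k : L (molecule y deltaN k) = molecule x deltaM k.
  by rewrite /molecule linearZZ linearB !Ld.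
(* Both sides are limits along the expansion of w in molecules. *)
have L_low w : pnorm w <= t * pnorm (L w).
  apply: (pnorm_le_pow p_gt0 t_ge0); rewrite -[w]US -[leRHS]addr0.
  apply: (pcvg_ge (powR_ge0 _ _) (S_cvg (U w))
    (pcvg_bounded p_gt0 ler01 Ln (S_cvg (U w)))) => n.
  rewrite addr0 /= linear_sum.
  apply: le_trans (pnorm_pow_sum p_gt0 _ _) _.
  under eq_bigr do rewrite pnorm_powZ (pnorm_molecule chN freeN) powR1 mulr1.
  apply: le_trans (molecule_lower p_gt0 p_le1 ch _ _ freeM) _.
  by under [X in _ <= _ * pnorm X `^ p]eq_bigr do rewrite linearZZ L_mol.
exists L; split=> //; split; first by exists 1 => z _; exact: Ln.
pose g z := xget 0 [set w | L w = z].
have gK : cancel L g.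
  move=> w; have Lg : L (g (L w)) = L w.
    by apply: (@xgetPex _ 0 [set w' | L w' = L w]); exists w.
  apply/eqP; rewrite -subr_eq0; apply/eqP/pnorm_eq0.
  apply/eqP; rewrite eq_le pnorm_ge0 andbT (le_trans (L_low _))//.
  by rewrite linearB Lg subrr pnorm0 mulr0.
have g_le z : range L z -> pnorm (g z) <= t * pnorm z.
  by move=> [w _ <-]; rewrite gK.
exists g; split=> //; first by exists t.
apply: le_trans tC; apply: opnorm_on_le => //.
by exists 0; rewrite ?linear0.
Qed.
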